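(* Let $K$ be a compact Hausdorff space and let $\aleph$ be an uncountable cardinal. The following statements are equivalent: (a) $C(K)$ is $(1,\aleph)$-injective. (b) Given nonempty subsets $L$ and $U$ of $C(K)$ with $|L|<\aleph$ and $|U|<\aleph$ such that $f\leq g$ for every $f\in L$ and every $g\in U$, there exists $h\in C(K)$ such that $f\leq h\leq g$ for all $f\in L$ and all $g\in U$. (c) Every family of mutually intersecting balls in $C(K)$ of cardinality less than $\aleph$ has nonempty intersection. (d) Any two disjoint open subsets $G$ and $H$ of $K$, each of which is the union of less than $\aleph$ many closed subsets of $K$, have disjoint closures. (e) Any two disjoint open subsets $G$ and $H$ of $K$, each of which is the union of less than $\aleph$ many cozero sets of $K$, have disjoint closures.
   Context: $C(K)$ is the Banach space of real-valued continuous functions on $K$ with the sup norm; inequalities between functions are pointwise. All Banach spaces are real, ''operator'' means bounded linear map, ''subspace'' means closed linear subspace. For a topological space $X$, $\operatorname{dens}(X)$ is the smallest cardinality of a dense subset. For an uncountable cardinal $\aleph$, a Banach space $E$ is $(1,\aleph)$-injective if for every Banach space $X$ with $\operatorname{dens}(X)<\aleph$ and every subspace $Y\subset X$, every operator $t:Y\to E$ has an extension to an operator $T:X\to E$ with $\|T\|\leq\|t\|$. Balls are closed balls $B(f,r)$; a family of balls is mutually intersecting if any two of its members have a common point. A cozero set of $K$ is an open set of the form $\{x\in K: f(x)\neq 0\}$ for some $f\in C(K)$. *)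

(* Defs.v *)
From HB Require Import structures.
From mathcomp Require Import all_boot all_order all_algebra.
From mathcomp Require Import all_classical all_reals all_analysis.
From mathcomp Require Import lra.

Set Implicit Arguments.
Unset Strict Implicit.
Unset Printing Implicit Defensive.

Import Order.TTheory GRing.Theory Num.Theory.
Import numFieldNormedType.Exports.

Local Open Scope classical_set_scope.
Local Open Scope ring_scope.
Local Open Scope card_scope.

(* A cardinal is represented by (the full set of) a type of that cardinality. *)
Definition card_lt T U (A : set T) (B : set U) : bool :=
  (A #<= B) && ~~ (B #<= A).
Notation "A '#<' B" := (card_lt A B)
  (at level 79, format "A  '#<'  B") : card_scope.

Section Density.
Variable X : topologicalType.

Definition least_dense (D : set X) : Prop :=
  dense D /\ forall D' : set X, dense D' -> D #<= D'.

(* A dense set of least cardinality, so that the cardinality of [dens X] is the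
   density of [X]. *)
Definition dens : set X := xget [set: X] least_dense.

Lemma dense_setT : dense [set: X].
Proof. by move=> V V0 _; rewrite setIT. Qed.

(* Cardinals are well ordered: take a maximal set [M] of choice functions on the
   dense sets that differ pairwise at every dense set. *)
Lemma least_dense_ex : exists D, least_dense D.
Proof.
pose P (M : set (set X -> X)) :=
  (forall f D, M f -> dense D -> D (f D)) /\
  (forall f g D, M f -> M g -> dense D -> f D = g D -> f = g).
have [F PF totF|M [[M1 M2] maxM]] := @Zorn_bigcup _ P.
  split=> [f D [M FM Mf]|f g D [M FM Mf] [N FN Ng] dD fg].
    exact: (PF _ FM).1.
  case: (totF _ _ FM FN) => [MN|NM].
    by apply: (PF _ FN).2 dD fg => //; exact: MN.
  by apply: (PF _ FM).2 dD fg => //; exact: NM.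
have [D [dD DM]] : exists D, dense D /\ D `<=` [set f D | f in M].
  apply: contrapT => noD.
  have gP D : exists x, dense D -> D x /\ ~ [set f D | f in M] x.
    have [dD|ndD] := pselect (dense D).
      have nDM : ~ (D `<=` [set f D | f in M]).
        by move=> DM; apply: noD; exists D.
      by move/existsNP : nDM => [x /not_implyP[Dx Mx]]; exists x.
    have /existsNP[V /not_implyP[[x _] _]] := ndD.
    by exists x.
  have [g {}gP] := choice gP.
  apply: (maxM (M `|` [set g])).
    split=> [f Mf|MgM]; first by left.
    have [_ []] := gP _ dense_setT.
    by exists g => //; apply: MgM; right.
  split=> [f D [Mf|->] dD|f f' D [Mf|->] [Mf'|->] dD ff'] //.
  - exact: M1 Mf dD.
  - exact: (gP _ dD).1.
  - exact: M2 Mf Mf' dD ff'.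
  - by have [_ []] := gP _ dD; exists f.
  - by have [_ []] := gP _ dD; exists f'.
exists D; split=> // D' dD'.
apply: (card_le_trans (subset_card_le DM)).
apply: (card_le_trans (card_image_le _ _)).
apply: (@card_le_trans _ _ _ [set f D' | f in M]); last first.
  by apply: subset_card_le => _ [f Mf <-]; exact: M1 Mf dD'.
suff : [set f D' | f in M] #= M by rewrite card_eq_le => /andP[].
by apply: inj_card_eq => f f' /[!inE] Mf Mf'; exact: M2 Mf Mf' dD'.
Qed.

Lemma densP : least_dense dens.
Proof. by have [D lD] := least_dense_ex; exact: (xgetPex _ (ex_intro _ D lD)). Qed.

End Density.
Arguments dens : clear implicits.

Section Operators.
Variables (R : realType) (X E : normedModType R).

Definition closed_subspace (Y : set X) : Prop := submod_closed [in Y] /\ closed Y.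

(* Maps defined on a subspace [Y] are total functions on [X] whose values
   outside [Y] are irrelevant. *)
Definition operator_on (Y : set X) (t : X -> E) : Prop :=
  (forall a : R, {in Y &, forall x y, t (a *: x + y) = a *: t x + t y}) /\
  exists M : R, {in Y, forall y, `|t y| <= M * `|y|}.

Definition opnorm (Y : set X) (t : X -> E) : R :=
  sup [set `|t y| | y in Y `&` [set y | `|y| <= 1]].

End Operators.

(* (1,aleph)-injectivity: norm-preserving extension of operators defined on
   subspaces of Banach spaces of density less than [aleph]. *)
Definition one_injective (R : realType) (aleph : Type)
    (E : completeNormedModType R) : Prop :=
  forall X : completeNormedModType R, dens X #< [set: aleph] ->
  forall Y : set X, closed_subspace Y ->
  forall t : X -> E, operator_on Y t ->
  exists T : X -> E, [/\ operator_on [set: X] T, {in Y, T =1 t} &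
    opnorm [set: X] T <= opnorm Y t].

(* Compactness is a parameter of the type so that the sup norm can be a
   canonical structure on it. *)
Definition CK (R : realType) (K : topologicalType) (cK : compact [set: K]) :
  Type := continuousType K R.

Section CKspace.
Variables (R : realType) (K : topologicalType) (cK : compact [set: K]).
Local Notation C := (CK R cK).
Implicit Types f g : C.

HB.instance Definition _ := Choice.copy C (continuousType K R).

Definition CK_fun f : K -> R := Continuous.sort f.
Local Coercion CK_fun : CK >-> Funclass.

Lemma CK_continuous f : continuous (f : K -> R).
Proof. exact: (@cts_fun K R f). Qed.

Definition mkCK (f : K -> R) (cf : continuous f) : C :=
  [the continuousType K R of mkcts cf].

Lemma CKP f g : (forall x, f x = g x) -> f = g.
Proof. by move=> fg; exact/(@continuousEP K R). Qed.

Definition CK0 : C := @mkCK (fun=> 0) (@cst_continuous K R 0).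
Definition CKopp f : C :=
  @mkCK (fun x => - f x) (fun x => cvgN (@CK_continuous f x)).
Definition CKadd f g : C :=
  @mkCK (fun x => f x + g x)
    (fun x => cvgD (@CK_continuous f x) (@CK_continuous g x)).
Definition CKscale (a : R) f : C :=
  @mkCK (fun x => a * f x)
    (fun x => cvgM (@cst_continuous K R a x) (@CK_continuous f x)).

Lemma CKaddA : associative CKadd.
Proof. by move=> f g h; apply: CKP => x; exact: addrA. Qed.
Lemma CKaddC : commutative CKadd.
Proof. by move=> f g; apply: CKP => x; exact: addrC. Qed.
Lemma CKadd0 : left_id CK0 CKadd.
Proof. by move=> f; apply: CKP => x; exact: add0r. Qed.
Lemma CKaddN : left_inverse CK0 CKopp CKadd.
Proof. by move=> f; apply: CKP => x; exact: addNr. Qed.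

HB.instance Definition _ :=
  GRing.isZmodule.Build C CKaddA CKaddC CKadd0 CKaddN.

Lemma CKscaleA a b f : CKscale a (CKscale b f) = CKscale (a * b) f.
Proof. by apply: CKP => x; exact: mulrA. Qed.
Lemma CKscale1 : left_id 1 CKscale.
Proof. by move=> f; apply: CKP => x; exact: mul1r. Qed.
Lemma CKscaleDr : right_distributive CKscale +%R.
Proof. by move=> a f g; apply: CKP => x; exact: mulrDr. Qed.
Lemma CKscaleDl f : {morph CKscale^~ f : a b / a + b}.
Proof. by move=> a b; apply: CKP => x; exact: mulrDl. Qed.

HB.instance Definition _ :=
  GRing.Zmodule_isLmodule.Build R C CKscaleA CKscale1 CKscaleDr CKscaleDl.

Definition CKnorm f : R := sup [set `|f x| | x in [set: K]].

Lemma CKnorm_has_ubound f : has_ubound [set `|f x| | x in [set: K]].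
Proof.
have cf : compact ((f : K -> R) @` [set: K]).
  apply: continuous_compact => //; apply: continuous_subspaceT => x.
  exact: CK_continuous.
have [M [_ MA]] := compact_bounded cf.
exists (M + 1) => _ [x _ <-]; apply: (MA (M + 1)); first by rewrite ltrDl.
by exists x.
Qed.

Lemma le_CKnorm f x : `|f x| <= CKnorm f.
Proof. by apply: ub_le_sup; [exact: CKnorm_has_ubound|exists x]. Qed.

(* [0 <= M] takes care of the empty space, where the sup is [0]. *)
Lemma CKnorm_le f (M : R) :
  0 <= M -> (forall x, `|f x| <= M) -> CKnorm f <= M.
Proof.
move=> M0 fM; have [K0|/set0P K0] := eqVneq [set `|f x| | x in [set: K]] set0.
  by rewrite /CKnorm K0 sup0.
by apply: ge_sup => // _ [x _ <-].
Qed.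

Lemma CKnorm_ge0 f : 0 <= CKnorm f.
Proof.
rewrite /CKnorm; have [->|/set0P[_ [x _ _]]] :=
  eqVneq [set `|f x| | x in [set: K]] set0; first by rewrite sup0.
exact: le_trans (le_CKnorm f x).
Qed.

Lemma CKnormD f g : CKnorm (f + g) <= CKnorm f + CKnorm g.
Proof.
apply: CKnorm_le => [|x]; first by rewrite addr_ge0 ?CKnorm_ge0.
by apply: le_trans (ler_normD _ _) _; rewrite lerD ?le_CKnorm.
Qed.

Lemma CKnormZ a f : CKnorm (a *: f) = `|a| * CKnorm f.
Proof.
have le b g : CKnorm (b *: g) <= `|b| * CKnorm g.
  apply: CKnorm_le => [|x]; first by rewrite mulr_ge0 ?CKnorm_ge0.
  by rewrite [X in X <= _]normrM ler_wpM2l ?le_CKnorm.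
apply/eqP; rewrite eq_le le/=.
have [->|a0] := eqVneq a 0; first by rewrite normr0 mul0r CKnorm_ge0.
rewrite -[in leLHS](scale1r f) -(mulVf a0) -scalerA.
apply: le_trans (ler_wpM2l _ (le _ _)) _ => //.
by rewrite mulrA -normrM divff// normr1 mul1r.
Qed.

Lemma CKnorm_eq0 f : CKnorm f = 0 -> f = 0.
Proof.
move=> f0; apply: CKP => x; apply/eqP; rewrite -normr_le0 -f0.
exact: le_CKnorm.
Qed.

HB.instance Definition _ :=
  @Lmodule_isNormed.Build R C CKnorm CKnormD CKnormZ CKnorm_eq0.

Lemma CK_normE f : `|f| = sup [set `|f x| | x in [set: K]].
Proof. by []. Qed.

Lemma CK_complete (F : set_system C) : ProperFilter F -> cauchy F -> cvg F.
Proof.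
move=> FF /cauchy_ballP cF.
have cl (x : K) : exists l : R, (f : C) x @[f --> F] --> l.
  apply/cvg_ex/cauchy_cvgP/cauchy_ballP => e e0.
  have [[A B] /= [FA FB] AB] := cF e e0.
  exists ([set f x | f in A], [set f x | f in B]) => /=.
    split; first by apply: filterS FA => f Af; exists f.
    by apply: filterS FB => f Bf; exists f.
  move=> [_ _] /= [[f Af <-] [g Bg <-]].
  have := AB (f, g) (conj Af Bg); rewrite -!ball_normE /= => fg.
  exact: le_lt_trans (le_CKnorm (f - g) x) fg.
have [l {}cl] := choice cl.
have unif (e : R) : 0 < e ->
    \forall f \near F, forall x, `|l x - (f : C) x| <= e.
  move=> e0; have := cF e e0; rewrite !near_simpl => /nearP_dep.
  apply: filterS => f fg x.
  have cf : `|(h : C) x - f x| @[h --> F] --> `|l x - f x|.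
    by apply: cvg_norm; apply: cvgB (cl x) (cvg_cst (f x)).
  apply: (closed_cvg (fun y : R => y <= e) (@closed_le R e) _ _ cf).
  apply: filterS fg => h; rewrite -ball_normE /= => fh.
  by rewrite distrC; apply: ltW; exact: le_lt_trans (le_CKnorm (f - h) x) fh.
have cts_l : continuous l.
  move=> x; apply/cvgrPdist_le => e e0.
  have e3 : 0 < e / 3 by rewrite divr_gt0.
  have /filter_ex[f fl] := unif _ e3.
  have /cvgrPdist_le/(_ _ e3) := @CK_continuous f x.
  rewrite !near_simpl; apply: filterS => y fxy.
  have -> : l x - l y = (l x - f x) + (f x - f y) + (f y - l y).
    by rewrite !addrA !subrK.
  have -> : e = e / 3 + e / 3 + e / 3 by lra.
  apply: le_trans (ler_normD _ _) _; apply: lerD; last by rewrite distrC fl.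
  by apply: le_trans (ler_normD _ _) _; exact: lerD.
apply/cvg_ex; exists (mkCK cts_l); apply/cvgrPdist_le => e e0.
apply: filterS (unif e e0) => f fl.
by apply: CKnorm_le; [exact: ltW|move=> x; exact: fl].
Qed.

HB.instance Definition _ := Uniform_isComplete.Build C CK_complete.

End CKspace.

Coercion CK_fun : CK >-> Funclass.

Definition cozero_set (R : realType) (K : topologicalType)
    (cK : compact [set: K]) (A : set K) : Prop :=
  exists f : CK R cK, A = [set x | f x != 0].

(* [G] is the union of fewer than [aleph] sets satisfying [P]. *)
Definition small_union (aleph T : Type) (P : set T -> Prop) (G : set T) :
    Prop :=
  exists F : set (set T), [/\ F #< [set: aleph], forall A, F A -> P A &
    G = \bigcup_(A in F) A].

(* Main.v *)
(* (a) => (b): adjoin to the continuous functions of L and U, the constant 1 and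
   h0 = sup L (pointwise, usually discontinuous), and let X be the closed span in
   l_oo(K).  The inclusion of X `&` C(K) into C(K) extends to a contraction
   T : X -> C(K); as T 1 = 1, T is positive, so T h0 lies between L and U.
   (b) => (c): a ball B(f, r) is the order interval [f - r, f + r].
   (c) => (d): the balls [u, u + 2] and [-v - 1, 1 - v], for Urysohn functions u
   of the closed pieces of G and v of those of H, are mutually intersecting, and
   a common point is >= 1 on G and <= 0 on H.
   (d) => (e): a cozero set is a countable union of closed sets.
   (e) => (b): as in Tietze's theorem, an approximate solution with error c is
   corrected by a function of norm at most c / 3 to one with error 2 c / 3.
   (b) => (a): extend by Zorn's lemma one vector x0 at a time; the value at x0
   has to lie between the functions t s - |t| |s - x0| and t s + |t| |s - x0|,
   for s in a small dense subset of the domain.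
   The cardinalities are controlled by |A * A| = |A| for infinite A. *)

Require Import Defs.
From HB Require Import structures.
From mathcomp Require Import all_boot all_order all_algebra.
From mathcomp Require Import all_classical all_reals all_analysis.
From mathcomp Require Import ring lra.

Set Implicit Arguments.
Unset Strict Implicit.
Unset Printing Implicit Defensive.

Import Order.TTheory GRing.Theory Num.Theory.
Import numFieldNormedType.Exports.

Local Open Scope classical_set_scope.
Local Open Scope ring_scope.
Local Open Scope card_scope.

(** * Zorn's lemma and infinite cardinals *)

(** Zorn's lemma is applied to the sets whose union with [G] satisfies [P]. The empty chain is then
    settled by [P G], so only nonempty chains remain as a hypothesis. *)
Lemma Zorn_bigcup_above T (P : set (set T)) (G : set T) : P G ->
  (forall F : set (set T), F !=set0 -> F `<=` P -> total_on F subset ->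
    P (\bigcup_(X in F) X)) ->
  exists M, [/\ P M, G `<=` M & forall N, M `<=` N -> P N -> N `<=` M].
Proof.
move=> PG Pcup.
have [F FP totF|M [PM maxM]] := @Zorn_bigcup _ [set A | P (A `|` G)].
  have [->|/set0P[A0 FA0]] := eqVneq F set0.
    by rewrite /= bigcup_set0 set0U.
  rewrite /mkset; have -> : \bigcup_(X in F) X `|` G =
      \bigcup_(X in [set A `|` G | A in F]) X.
    apply/seteqP; split=> [x [[A FA Ax]|Gx]|x [_ [A FA <-] [Ax|Gx]]].
    - by exists (A `|` G); [exists A|left].
    - by exists (A0 `|` G); [exists A0|right].
    - by left; exists A.
    - by right.
  apply: Pcup; first by exists (A0 `|` G); exists A0.
  - by move=> _ [A FA <-]; exact: FP.
  - by move=> _ _ [A FA <-] [B FB <-]; have [AB|BA] := totF _ _ FA FB;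
      [left|right]; exact: setSU.
exists (M `|` G); split=> // N MN PN; apply: contrapT => NM.
apply: (maxM N); last by rewrite /= (setUidl (subset_trans (@subsetUr _ _ _) MN)).
split; first exact: subset_trans (@subsetUl _ _ _) MN.
by move=> NM'; apply: NM => x /NM'; left.
Qed.

(** A maximal graph of a partial injection is total on one of the two sides: otherwise a pair of
    unmatched points could be added. *)
Lemma inj_or_inj T U :
  (exists f : T -> U, injective f) \/ (exists g : U -> T, injective g).
Proof.
pose P (G : set (T * U)) :=
  forall p q, G p -> G q -> p.1 = q.1 \/ p.2 = q.2 -> p = q.
have [F FP totF|M [PM maxM]] := @Zorn_bigcup _ P.
  move=> p q [A FA Ap] [B FB Bq].
  by have [/(_ p Ap)|/(_ q Bq)] := totF _ _ FA FB; [move: p {Ap} q Bq|];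
    [move=> p q Bq Bp; exact: FP Bp Bq|move=> Aq; exact: FP Ap Aq].
have [/choice[f Mf]|/existsNP[x Mx]] := pselect (forall x, exists y, M (x, y)).
  left; exists f => x y fxy.
  by have [] := PM _ _ (Mf x) (Mf y) (or_intror fxy).
have [/choice[g Mg]|/existsNP[y My]] := pselect (forall y, exists x, M (x, y)).
  right; exists g => u v guv.
  by have [] := PM _ _ (Mg u) (Mg v) (or_introl guv).
exfalso; apply: (maxM (M `|` [set (x, y)])).
  split=> [p Mp|sub]; first by left.
  by apply: Mx; exists y; apply: sub; right.
move=> [a b] [c d] [Mp|[-> ->]] [Mq|[-> ->]] //=; first exact: (PM _ _ Mp Mq).
- by case=> [ax|bx]; exfalso; [apply: Mx; exists b; rewrite -ax
                              |apply: My; exists a; rewrite -bx].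
- by case=> [ax|bx]; exfalso; [apply: Mx; exists d; rewrite ax
                              |apply: My; exists c; rewrite bx].
Qed.

(* M is the graph of an injection from D * D to D with D as large as possible.
   If the complement of D does not embed into D, then D has a copy e D disjoint
   from it, and e D has room for the new part of (D `|` e D) * (D `|` e D). *)
Lemma square_inj T (i : nat -> T) : injective i ->
  exists f : T * T -> T, injective f.
Proof.
move=> i_inj.
(* The carrier of [M] is read off the diagonal, so the graph alone holds all the data and chains can
   be joined by unions. *)
pose D (M : set ((T * T) * T)) : set T := [set x | exists z, M ((x, x), z)].
pose P (M : set ((T * T) * T)) :=
  [/\ forall x y z, M ((x, y), z) -> [/\ D M x, D M y & D M z],
      forall x y, D M x -> D M y -> exists z, M ((x, y), z) &
      forall p q, M p -> M q -> p.1 = q.1 \/ p.2 = q.2 -> p = q].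
(* The start is the pairing of natural numbers carried over by [i]; every carrier above it contains
   all [i n]. *)
pose M0 : set ((T * T) * T) :=
  [set ((i mn.1, i mn.2), i (choice.pickle mn)) | mn in [set: nat * nat]].
have D0 n : D M0 (i n) by exists (i (choice.pickle (n, n))); exists (n, n).
have [||M [[M1 M2 M3] M0M maxM]] := @Zorn_bigcup_above _ P M0.
- split.
  + by move=> x y z [[m n] _ /= [<- <- <-]].
  + move=> x y [z [[m m'] _ /= [<- _ _]]] [z' [[n n'] _ /= [<- _ _]]].
    by exists (i (choice.pickle (m, n))); exists (m, n).
  + move=> _ _ [[m n] _ <-] [[m' n'] _ <-] /=.
    by case=> [[/i_inj-> /i_inj->]|/i_inj/(pcan_inj choice.pickleK)[-> ->]].
- move=> F _ FP totF.
  have DF A x : F A -> D A x -> D (\bigcup_(X in F) X) x.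
    by move=> FA [z Az]; exists z; exists A.
  split.
  + move=> x y z [A FA]; have [F1 _ _] := FP _ FA => /F1[Dx Dy Dz].
    by split; apply: DF FA _.
  + move=> x y [z [A FA Az]] [z' [B FB Bz']].
    have [AB|BA] := totF _ _ FA FB.
      have [_ + _] := FP _ FB => /(_ x y)[|| w Bw]; last by exists w; exists B.
        by exists z; exact: AB.
      by exists z'.
    have [_ + _] := FP _ FA => /(_ x y)[|| w Aw]; last by exists w; exists A.
      by exists z.
    by exists z'; exact: BA.
  + move=> p q [A FA Ap] [B FB Bq].
    by have [AB|BA] := totF _ _ FA FB;
      [have [_ _] := FP _ FB|have [_ _] := FP _ FA];
      apply => //; [exact: AB|exact: BA].
have Di n : D M (i n) by have [z Mz] := D0 n; exists z; exact: M0M.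
have /choice[f fP] : forall p : T * T, exists z, D M p.1 -> D M p.2 -> M (p, z).
  move=> [x y] /=; have [[Dx Dy]|nD] := pselect (D M x /\ D M y).
    by have [z Mz] := M2 _ _ Dx Dy; exists z.
  by exists (i 0%N) => Dx Dy; exfalso; apply: nD.
have fD x y : D M x -> D M y -> D M (f (x, y)).
  by move=> Dx Dy; have /M1[] := fP (x, y) Dx Dy.
have f_inj x y x' y' : D M x -> D M y -> D M x' -> D M y' ->
    f (x, y) = f (x', y') -> x = x' /\ y = y'.
  move=> Dx Dy Dx' Dy' ff.
  have Mf := fP (x, y) Dx Dy; have Mf' := fP (x', y') Dx' Dy'.
  by have [-> ->] := M3 _ _ Mf Mf' (or_intror ff).
have [[g g_inj]|[e0 e0_inj]] := inj_or_inj (~` D M) (D M).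
  (* The tags [i 0] and [i 1] keep the two branches apart, so [h] embeds all of [T] into [D M]. *)
  pose h x := if pselect ((~` D M) x) is left nDx
    then f (i 0%N, val (g (SigSub (mem_set nDx)))) else f (i 1%N, x).
  have hD x : D M (h x).
    rewrite /h; case: pselect => [nDx|/contrapT Dx]; apply: fD => //.
    exact: set_valP.
  have h_inj : injective h.
    move=> x y; rewrite /h.
    case: pselect => [nDx|/contrapT Dx]; case: pselect => [nDy|/contrapT Dy];
      move=> /f_inj[] //; try exact: set_valP; try by move=> /i_inj.
    by move=> _ /val_inj/g_inj/(congr1 val).
  exists (fun p => f (h p.1, h p.2)) => -[x y] [x' y'] /= /f_inj[] //.
  by move=> /h_inj -> /h_inj ->.
have /choice[e eP] : forall d, exists x, forall Dd : D M d,
    x = val (e0 (SigSub (mem_set Dd))).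
  move=> d; have [Dd|nDd] := pselect (D M d); last by exists d => Dd.
  exists (val (e0 (SigSub (mem_set Dd)))) => Dd'.
  by congr (val (e0 _)); exact: val_inj.
have eND d : D M d -> ~ D M (e d).
  by move=> Dd; rewrite (eP _ Dd); exact: (set_valP (e0 _)).
have e_inj d d' : D M d -> D M d' -> e d = e d' -> d = d'.
  move=> Dd Dd'; rewrite (eP _ Dd) (eP _ Dd').
  by move=> /val_inj/e0_inj/(congr1 val).
pose v (b : bool) d := if b then e d else d.
have v_inj b b' d d' : D M d -> D M d' -> v b d = v b' d' -> b = b' /\ d = d'.
  move=> Dd Dd'; case: b; case: b' => //=.
  - by move=> /e_inj->.
  - by move=> ed; exfalso; apply: (eND d) => //; rewrite ed.
  - by move=> ed; exfalso; apply: (eND d') => //; rewrite -ed.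
(* The two tags and the two points are packed into one point of [D M]; its copy under [e] is the
   value of the new pair. *)
pose code b1 b2 d1 d2 := f (f (i (choice.pickle (b1 : bool, b2 : bool)), d1), d2).
have codeD b1 b2 d1 d2 : D M d1 -> D M d2 -> D M (code b1 b2 d1 d2).
  by move=> D1 D2; exact: (fD _ _ (fD _ _ (Di _) D1) D2).
pose N := M `|` [set p | exists b1 b2 d1 d2, [/\ b1 || b2, D M d1, D M d2 &
  p = ((v b1 d1, v b2 d2), e (code b1 b2 d1 d2))]].
have DN b d : D M d -> D N (v b d).
  move=> Dd; case: b; last by have [z Mz] := Dd; exists z; left.
  by exists (e (code true true d d)); right; exists true, true, d, d.
have DNP x : D N x -> exists b d, D M d /\ x = v b d.
  move=> [z [Mz|[b1 [b2 [d1 [d2 [_ D1 D2 [-> _ _]]]]]]]].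
    by exists false, x; split=> //; exists z.
  by exists b1, d1.
(* Maximality will force [N] inside [M], which puts [e (i 0)] in [D M], a contradiction. *)
have [] // := eND (i 0%N) _.
have /M1[] // : M ((e (i 0%N), e (i 0%N)), e (code true true (i 0%N) (i 0%N))).
apply: (maxM N); first by move=> p Mp; left.
  split.
  - move=> x y z [/M1[Dx Dy Dz]|[b1 [b2 [d1 [d2 [_ D1 D2 [-> -> ->]]]]]]].
      by split; [exact: (DN false)|exact: (DN false)|exact: (DN false)].
    by split; [exact: DN|exact: DN|exact: (DN true _ (codeD _ _ _ _ D1 D2))].
  - move=> _ _ /DNP[b1 [d1 [D1 ->]]] /DNP[b2 [d2 [D2 ->]]].
    have [b12|] := boolP (b1 || b2).
      by exists (e (code b1 b2 d1 d2)); right; exists b1, b2, d1, d2.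
    rewrite negb_or => /andP[/negPf-> /negPf->].
    by exists (f (d1, d2)); left; exact: fP (d1, d2) D1 D2.
  (* An old and a new triple agree neither in arguments nor in value: the value and at least one
     argument of the new one lie in the copy, outside [D M]. *)
  - have MN (p q : (T * T) * T) b1 b2 d1 d2 :
      M p -> b1 || b2 -> D M d1 -> D M d2 ->
      q = ((v b1 d1, v b2 d2), e (code b1 b2 d1 d2)) ->
      ~ (p.1 = q.1 \/ p.2 = q.2).
      case: p => -[x y] z /M1[Dx Dy Dz] b12 D1 D2 -> /=; case=> [[]|] ez.
        case/orP: b12 => b1t; rewrite b1t /= in ez *.
          by move=> _; apply: (eND d1 D1); rewrite -ez.
        by move=> ey; apply: (eND d2 D2); rewrite -ey.
      by apply: (eND _ (codeD b1 b2 _ _ D1 D2)); rewrite -ez.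
    move=> p q [Mp|[b1 [b2 [d1 [d2 [b12 D1 D2 pE]]]]]].
      move=> [Mq|[b1 [b2 [d1 [d2 [b12 D1 D2 qE]]]]]]; first exact: M3.
      by move=> /(MN p q _ _ _ _ Mp b12 D1 D2 qE).
    move=> [Mq|[c1 [c2 [k1 [k2 [c12 K1 K2 qE]]]]]].
      move=> pq; exfalso; apply: (MN q p _ _ _ _ Mq b12 D1 D2 pE).
      by case: pq => ->; [left|right].
    rewrite pE qE /= => -[[/v_inj[]// -> -> /v_inj[]// -> ->]//|].
    move=> /(e_inj _ _ (codeD _ _ _ _ D1 D2) (codeD _ _ _ _ K1 K2)).
    move=> /(f_inj _ _ _ _ (fD _ _ (Di _) D1) D2 (fD _ _ (Di _) K1) K2)[].
    by move=> /f_inj[]// /i_inj/(pcan_inj choice.pickleK)[-> ->] -> ->.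
by right; exists true, true, (i 0%N), (i 0%N).
Qed.

(** The length is coded next to the fold, because the end mark [i 0] may also be the fold of a
    nonempty sequence. *)
Lemma seq_inj T (i : nat -> T) : injective i ->
  exists f : seq (nat * T) -> T, injective f.
Proof.
move=> i_inj; have [f f_inj] := square_inj i_inj.
pose c (s : seq (nat * T)) := foldr (fun p x => f (f (i p.1, p.2), x)) (i 0%N) s.
exists (fun s => f (i (size s), c s)) => s t /f_inj[/i_inj].
elim: s t => [|[m x] s IHs] [|[n y] t]//= [st] /f_inj[/f_inj[/i_inj-> ->] ct].
by rewrite (IHs t).
Qed.

Lemma inj_card_leT T U (f : T -> U) : injective f -> [set: T] #<= [set: U].
Proof.
move=> f_inj; rewrite -(card_le_eql (@inj_card_eq _ _ setT f _)).
  exact: subset_card_le.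
by move=> x y _ _; exact: f_inj.
Qed.

Lemma card_le_injT T U : [set: T] #<= [set: U] -> exists f : T -> U, injective f.
Proof.
move=> /card_leP[f]; have f_inj : {in setT &, injective f} by exact: inj.
exists (fun x => val (f (to_setT x))) => x y /val_inj.
by move=> /(f_inj _ _ (in_setT _) (in_setT _))/(congr1 val).
Qed.

Lemma card_le_lt_trans T U V (A : set T) (B : set U) (C : set V) :
  A #<= B -> B #< C -> A #< C.
Proof.
move=> AB /andP[ltB nCB]; apply/andP; split; first exact: card_le_trans ltB.
by apply: contra nCB => CA; exact: card_le_trans AB.
Qed.

(** * Sets smaller than an uncountable cardinal *)

Section Uncountable.
Variable C : Type.
Hypothesis C_uncountable : ~ countable [set: C].

Lemma countable_card_lt T (A : set T) : countable A -> A #< [set: C].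
Proof.
move=> cA; apply/andP; split.
  apply: card_le_trans cA _; apply/infiniteP => /finite_set_countable.
  exact: C_uncountable.
by apply/negP => CA; apply: C_uncountable; exact: sub_countable cA.
Qed.

(** A countable [A] has only countably many sequences, and an uncountable one absorbs its sequences
    by [seq_inj]. *)
Lemma card_lt_seq T (A : set T) :
  A #< [set: C] -> [set: seq (nat * A)] #< [set: C].
Proof.
move=> ltA; have [cA|ncA] := pselect (countable A).
  apply: countable_card_lt.
  have /card_le_injT[f f_inj] : [set: A] #<= [set: nat].
    by rewrite (card_le_eql (card_setT A)).
  apply: (@card_le_trans _ _ _ [set: seq (nat * nat)]); last exact: countableP.
  apply: (@inj_card_leT _ _ (map (fun p => (p.1, f p.2)))).
  by apply: inj_map => -[m x] [n y] /= [-> /f_inj->].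
apply: card_le_lt_trans ltA.
have /infiniteP : infinite_set A by move=> /finite_set_countable.
rewrite -(card_le_eqr (card_setT A)) => /card_le_injT[i].
move=> /seq_inj[f] /inj_card_leT h.
by rewrite -(card_le_eqr (card_setT A)).
Qed.

(** A pair is a sequence of length one. *)
Lemma card_lt_setX_nat T (A : set T) :
  A #< [set: C] -> A `*` [set: nat] #< [set: C].
Proof.
move=> ltA; apply: card_le_lt_trans (card_lt_seq ltA).
rewrite -(card_le_eql (card_setT _)).
pose B : set (T * nat) := A `*` [set: nat].
pose g (p : B) : seq (nat * A) :=
  [:: ((val p).2, SigSub (mem_set (proj1 (set_valP p))))].
apply: (@inj_card_leT _ _ g) => -[[x m] p] [[y n] q] [/= mn xy].
by apply: val_inj; rewrite /= mn xy.
Qed.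

Lemma card_lt_setU T (A B : set T) :
  A #< [set: C] -> B #< [set: C] -> A `|` B #< [set: C].
Proof.
wlog : A B / A #<= B => [wl ltA ltB|AB ltA ltB].
  have [[f f_inj]|[f f_inj]] := inj_or_inj A B; last rewrite setUC.
    apply: wl => //; rewrite -(card_le_eql (card_setT _)).
    by rewrite -(card_le_eqr (card_setT _)); exact: inj_card_leT f_inj.
  apply: wl => //; rewrite -(card_le_eql (card_setT _)).
  by rewrite -(card_le_eqr (card_setT _)); exact: inj_card_leT f_inj.
apply: card_le_lt_trans (card_lt_setX_nat ltB).
have /card_le_injT[f f_inj] : [set: A] #<= [set: B].
  by rewrite (card_le_eql (card_setT _)) (card_le_eqr (card_setT _)).
have [->|/set0P[b0 Bb0]] := eqVneq (A `|` B) set0; first exact: card_ge0.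
(* Tag 0 marks [A], embedded into [B]; tag 1 marks the rest of [B]. *)
pose g x : T * nat := if pselect (A x) is left Ax
  then (val (f (SigSub (mem_set Ax))), 0%N) else (x, 1%N).
rewrite -(card_le_eql (@inj_card_eq _ _ _ g _)).
  apply: subset_card_le => _ [x ABx <-]; rewrite /g.
  case: pselect => [Ax|nAx]; split=> //=; first exact: set_valP.
  by case: ABx.
move=> x y _ _; rewrite /g; case: pselect => Ax; case: pselect => Ay [] //.
by move=> /val_inj/f_inj/(congr1 val).
Qed.

End Uncountable.

(** * Order interpolation, intersection of balls and separation of open sets *)

Section Properties.
Variables (R : realType) (K : topologicalType) (cK : compact [set: K]).
Variable aleph : Type.
Local Notation C := (CK R cK).

Definition interpolation : Prop :=
  forall L U : set C, L !=set0 -> U !=set0 ->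
    L #< [set: aleph] -> U #< [set: aleph] ->
    (forall f g, L f -> U g -> forall x, f x <= g x) ->
    exists h : C, (forall f, L f -> forall x, f x <= h x) /\
      (forall g, U g -> forall x, h x <= g x).

Definition ball_intersection : Prop :=
  forall B : set (set C), B #< [set: aleph] ->
    (forall A, B A -> exists f r, 0 <= r /\ A = closed_ball_ Num.norm f r) ->
    (forall A A', B A -> B A' -> A `&` A' !=set0) ->
    \bigcap_(A in B) A !=set0.

(** This is (d) when [P] is closedness and (e) when [P] is being a cozero set. *)
Definition small_open_separation (P : set K -> Prop) : Prop :=
  forall G H : set K, open G -> open H -> G `&` H = set0 ->
    small_union aleph P G -> small_union aleph P H ->
    closure G `&` closure H = set0.

End Properties.

(** * Continuous functions and cozero sets; (e) => (b) *)

Section ContinuousFunctions.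
Variables (R : realType) (K : topologicalType) (cK : compact [set: K]).
Hypothesis hK : hausdorff_space K.
Variable aleph : Type.
Local Notation C := (CK R cK).
Implicit Types f g h : C.

Definition CKcst (a : R) : C := @mkCK R K cK (fun=> a) (@cst_continuous K R a).

Lemma CKcstE a x : CKcst a x = a. Proof. by []. Qed.
Lemma CK0E x : CK_fun (0 : C) x = 0. Proof. by []. Qed.
Lemma CKDE f g x : CK_fun (f + g) x = f x + g x. Proof. by []. Qed.
Lemma CKNE f x : CK_fun (- f) x = - f x. Proof. by []. Qed.
Lemma CKZE a f x : CK_fun (a *: f) x = a * f x. Proof. by []. Qed.
Definition CKE := (CKcstE, CK0E, CKDE, CKNE, CKZE).

Lemma CK_norm_leP f a : 0 <= a -> `|f| <= a <-> forall x, - a <= f x <= a.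
Proof.
move=> a0; split=> [fa x|fa]; last by apply: CKnorm_le => // x; rewrite ler_norml.
by rewrite -ler_norml; exact: le_trans (le_CKnorm f x) fa.
Qed.

Lemma CK_norm_bounds f x : - `|f| <= f x <= `|f|.
Proof. exact: (CK_norm_leP f (normr_ge0 f)).1 (lexx _) x. Qed.

Lemma CK_urysohn (A B : set K) (a b : R) : closed A -> closed B ->
  A `&` B = set0 -> a < b ->
  exists f, [/\ forall x, a <= f x <= b, forall x, A x -> f x = a &
                forall x, B x -> f x = b].
Proof.
move=> cA cB AB ab.
have [f [cf fA fB fab]] :=
  urysohn_ext_itv (compact_normal hK cK) cA cB AB ab.
exists (mkCK cK cf); split=> x.
- by have := fab (f x) (ex_intro2 _ _ x I erefl); rewrite /= in_itv.
- by move=> Ax; apply: fA; exists x.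
- by move=> Bx; apply: fB; exists x.
Qed.

Lemma cozero_gt0 f : cozero_set R cK [set x | 0 < f x].
Proof.
(* [f + |f|] is twice the positive part of [f], so it is nonzero exactly where [f] is positive. *)
have cg : continuous (fun x => f x + `|f x|).
  move=> x; apply: (@continuousD R R^o); first exact: CK_continuous.
  by apply: continuous_comp; [exact: CK_continuous|exact: norm_continuous].
exists (mkCK cK cg); apply/seteqP; split=> x.
  change (0 < f x -> f x + `|f x| != 0) => f0.
  by rewrite gtr0_norm// gt_eqF// addr_gt0.
change (f x + `|f x| != 0 -> 0 < f x).
by apply: contraNT; rewrite -leNgt => f0; rewrite ler0_norm// subrr.
Qed.

Lemma open_cozero (A : set K) : cozero_set R cK A -> open A.
Proof.
move=> [f ->]; apply: (open_comp (D := [set y | y != 0])); last exact: open_neq.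
by move=> x _; exact: CK_continuous.
Qed.

Lemma small_cozero_union (L : set C) (F : C -> C) : L #< [set: aleph] ->
  small_union aleph (cozero_set R cK)
    [set x | exists2 f, L f & 0 < F f x].
Proof.
move=> ltL; exists [set [set x | 0 < F f x] | f in L]; split.
- exact: card_le_lt_trans (card_image_le _ _) ltL.
- by move=> _ [f Lf <-]; exact: cozero_gt0.
- apply/seteqP; split=> [x [f Lf fx]|x [_ [f Lf <-] fx]]; last by exists f.
  by exists [set x | 0 < F f x] => //; exists f.
Qed.

Lemma open_small_cozero_union (G : set K) :
  small_union aleph (cozero_set R cK) G -> open G.
Proof.
by move=> [F [_ FP ->]]; apply: bigcup_open => A /FP; exact: open_cozero.
Qed.

Lemma separation_interpolation :
  small_open_separation aleph (cozero_set R cK) ->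
  interpolation R cK aleph.
Proof.
move=> sep L U [f0 Lf0] [g0 Ug0] ltL ltU LU.
pose err (c : R) h := (forall f, L f -> forall x, f x <= h x + c) /\
  (forall g, U g -> forall x, h x <= g x + c).
have step (ch : R * C) : exists k : C, 0 < ch.1 -> err ch.1 ch.2 ->
    `|k| <= ch.1 / 3 /\ err (ch.1 * (2 / 3)) (ch.2 + k).
  case: ch => c h /=; have [c0|] := ltP 0 c; last by exists 0.
  (* [G] is where [h] is too small by more than [c / 3] for some [f], and [H] where it is too large
     by more than [c / 3] for some [g]; they are disjoint because [f <= g]. *)
  pose FG f : C := f - h - CKcst (c / 3); pose FH g : C := h - g - CKcst (c / 3).
  have sG := small_cozero_union FG ltL; have sH := small_cozero_union FH ltU.
  set G := [set x | _] in sG; set H := [set x | _] in sH.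
  have GH : G `&` H = set0.
    apply/seteqP; split=> // x [[f Lf] + [g Ug]]; rewrite /FG /FH !CKE => fx gx.
    by have := LU f g Lf Ug x; lra.
  have cGH := sep _ _ (open_small_cozero_union sG) (open_small_cozero_union sH)
    GH sG sH.
  rewrite setIC in cGH.
  (* On [G], adding [c / 3] lowers the error towards [L] from [c] to [2 c / 3]. Off [G] that error
     is at most [c / 3], and [k] adds at most [c / 3] to it. [H] plays the same role for [U]. *)
  have [k [kb kH kG]] : exists f, [/\ forall x, - (c / 3) <= f x <= c / 3,
      forall x, closure H x -> f x = - (c / 3) &
      forall x, closure G x -> f x = c / 3].
    by apply: CK_urysohn cGH _; [exact: closed_closure|exact: closed_closure|lra].
  exists k => _ [Lh Uh]; split; first by apply/CK_norm_leP => //; lra.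
  split=> f Lf x; rewrite CKE.
    have [Gx|nGx] := pselect (G x).
      by rewrite kG; [have := Lh _ Lf x; lra|exact: subset_closure].
    have : ~ 0 < FG f x by move=> fx; apply: nGx; exists f.
    by rewrite /FG !CKE; have := kb x; lra.
  have [Hx|nHx] := pselect (H x).
    by rewrite kH; [have := Uh _ Lf x; lra|exact: subset_closure].
  have : ~ 0 < FH f x by move=> fx; apply: nHx; exists f.
  by rewrite /FH !CKE; have := kb x; lra.
have /choice[k kP] := step.
(* An error bound for the start [h = 0], from [f <= g0] on [L] and [f0 <= g] on [U]; the 1 makes it
   positive. *)
pose c0 := `|f0| + `|g0| + 1.
pose c_ := geometric c0 (2 / 3).
pose h_ := fix h n := if n is n.+1 then h n + k (c_ n, h n) else 0.
pose g_ n := k (c_ n, h_ n).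
have c0_gt0 : 0 < c0.
  by rewrite ltr_wpDl// addr_ge0.
have c_gt0 n : 0 < c_ n by rewrite mulr_gt0// exprn_gt0.
have lt231 : `|2 / 3| < 1 :> R by rewrite ger0_norm//; lra.
have errn n : err (c_ n) (h_ n).
  elim: n => [|n IHn]; last first.
    have [_] := kP (c_ n, h_ n) (c_gt0 n) IHn.
    by rewrite /= /c_ /geometric /= exprSr mulrA.
  rewrite /c_ /= expr0 mulr1; split=> f Hf x; rewrite CK0E ?add0r.
    have := LU _ _ Hf Ug0 x; have := CK_norm_bounds g0 x.
    by have := normr_ge0 f0; rewrite /c0; lra.
  have := LU _ _ Lf0 Hf x; have := CK_norm_bounds f0 x.
  by have := normr_ge0 g0; rewrite /c0; lra.
have hE : h_ = series g_.
  apply/funext; elim=> [|n IHn]; first by rewrite /series /= big_geq.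
  by rewrite seriesSr -IHn.
have /cvg_ex[h hlim] : cvgn (series g_).
  apply: normed_cvg; apply: (@series_le_cvg _ _ (geometric (c0 / 3) (2 / 3))).
  - by move=> n; exact: normr_ge0.
  - by move=> n; rewrite mulr_ge0// ?exprn_ge0// divr_ge0// ltW.
  - move=> n; have [+ _] := kP (c_ n, h_ n) (c_gt0 n) (errn n).
    by rewrite /= mulrAC.
  - exact: is_cvg_geometric_series.
(* One half of [e] absorbs the error [c_ n], the other the distance from [h_ n] to the limit. *)
have close (e : R) : 0 < e -> exists n, c_ n <= e / 2 /\
    forall x, - (e / 2) <= CK_fun (h - h_ n) x <= e / 2.
  move=> e0; have e20 : 0 < e / 2 by lra.
  have /cvgrPdist_le/(_ _ e20) := hlim; rewrite -hE.
  have /cvgrPdist_le/(_ _ e20) := cvg_geometric c0 lt231.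
  move=> Fc Fh; have [n [/= cn hn]] := filter_ex (filterI Fc Fh).
  exists n; split; first by apply: le_trans cn; rewrite sub0r normrN ler_norm.
  by apply/CK_norm_leP; first exact: ltW.
exists h; split=> f Hf x; apply/ler_addgt0Pr => e /close[n [cn]].
  by move/(_ x); rewrite !CKE; have := (errn n).1 f Hf x; lra.
by move/(_ x); rewrite !CKE; have := (errn n).2 f Hf x; lra.
Qed.

End ContinuousFunctions.

(** * Balls, Urysohn functions and separation; (b) => (c) => (d) => (e) *)

Section Separation.
Variables (R : realType) (K : topologicalType) (cK : compact [set: K]).
Hypothesis hK : hausdorff_space K.
Variable aleph : Type.
Hypothesis aleph_uncountable : ~ countable [set: aleph].
Local Notation C := (CK R cK).
Implicit Types f g h : C.

Lemma closed_ballE f (r : R) : 0 <= r ->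
  closed_ball_ Num.norm f r = [set h : C | forall x, f x - r <= h x <= f x + r].
Proof.
move=> r0; apply/seteqP; split=> h /=.
  move=> /CK_norm_leP => /(_ r0) fh x; have := fh x.
  by rewrite !CKE; lra.
move=> fh; apply/CK_norm_leP => // x; have := fh x.
by rewrite !CKE; lra.
Qed.

Lemma interpolation_ball_intersection :
  interpolation R cK aleph -> ball_intersection R cK aleph.
Proof.
move=> interp B ltB ballB meetB.
(* The empty family is set apart, since interpolation asks for nonempty [L] and [U]. *)
have [->|/set0P[A0 BA0]] := eqVneq B set0; first by exists 0.
have /choice[c cP] : forall A, exists c : C * R, B A ->
    forall h : C, A h <-> forall x, c.1 x - c.2 <= h x <= c.1 x + c.2.
  move=> A; have [BA|] := pselect (B A); last by exists (0, 0).
  have [f [r [r0 AE]]] := ballB A BA; exists (f, r) => _ h.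
  by rewrite AE closed_ballE.
pose l A : C := (c A).1 - CKcst cK (c A).2.
pose u A : C := (c A).1 + CKcst cK (c A).2.
have [||||f g|h [lh hu]] := interp (l @` B) (u @` B).
- by exists (l A0), A0.
- by exists (u A0), A0.
- exact: card_le_lt_trans (card_image_le _ _) ltB.
- exact: card_le_lt_trans (card_image_le _ _) ltB.
(* A common point of two balls lies above the lower function of one and below the upper function of
   the other. *)
- move=> [A BA <-] [A' BA' <-] x; have [h []] := meetB _ _ BA BA'.
  move=> /(cP _ BA)/(_ x) + /(cP _ BA')/(_ x).
  by rewrite /l /u !CKE; lra.
exists h => A BA; apply/(cP _ BA) => x.
have := lh _ (ex_intro2 _ _ A BA erefl) x.
have := hu _ (ex_intro2 _ _ A BA erefl) x.
by rewrite /l /u !CKE; lra.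
Qed.

Lemma closed_CK_le (a : R) f : closed [set x | a <= f x].
Proof.
apply: (preimage_closed (D := [set y | a <= y])); last exact: closed_ge.
by move=> x _; exact: CK_continuous.
Qed.

Lemma closed_CK_ge (a : R) f : closed [set x | f x <= a].
Proof.
apply: (preimage_closed (D := [set y | y <= a])); last exact: closed_le.
by move=> x _; exact: CK_continuous.
Qed.

Lemma Urysohn_family (G : set K) (F : set (set K)) : open G ->
  (forall A, F A -> closed A) -> G = \bigcup_(A in F) A ->
  exists u : set K -> C, forall A, F A ->
    [/\ forall x, 0 <= u A x <= 1, forall x, ~ G x -> u A x = 0 &
        forall x, A x -> u A x = 1].
Proof.
move=> oG Fcl GE.
suff /choice[u uP] : forall A, exists f, F A ->
    [/\ forall x, 0 <= f x <= 1, forall x, ~ G x -> f x = 0 &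
        forall x, A x -> f x = 1] by exists u.
move=> A.
have [FA|] := pselect (F A); last by exists 0.
have [||||f fP] := @CK_urysohn R _ cK hK (~` G) A 0 1.
- exact: open_closedC.
- exact: Fcl.
- by apply/seteqP; split=> // x [Gx Ax]; apply: Gx; rewrite GE; exists A.
- exact: ltr01.
by exists f.
Qed.

Lemma ball_intersection_separation :
  ball_intersection R cK aleph -> small_open_separation aleph (@closed K).
Proof.
move=> balls G H oG oH GH [F [ltF Fcl GE]] [E [ltE Ecl HE]].
have [u uP] := Urysohn_family oG Fcl GE.
have [v vP] := Urysohn_family oH Ecl HE.
pose bu A : set C := closed_ball_ Num.norm (u A + CKcst cK 1) 1.
pose bv A : set C := closed_ball_ Num.norm (- v A) 1.
have buE A h : bu A h <-> forall x, u A x <= h x <= u A x + 2.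
  rewrite /bu closed_ballE//; split=> hA x; have := hA x; rewrite !CKE; lra.
have bvE A h : bv A h <-> forall x, - v A x - 1 <= h x <= 1 - v A x.
  rewrite /bv closed_ballE//; split=> hA x; have := hA x; rewrite !CKE; lra.
(* Witnesses for mutual intersection: 1 lies in every [bu A], 0 in every [bv A], and [u A] lies in
   both [bu A] and [bv A'], because [v A'] vanishes on [G] and [u A] vanishes off [G]. *)
have bu1 A : F A -> bu A (CKcst cK 1).
  by move=> /uP[u01 _ _]; apply/buE => x; have := u01 x; rewrite !CKE; lra.
have bv0 A : E A -> bv A 0.
  by move=> /vP[v01 _ _]; apply/bvE => x; have := v01 x; rewrite !CKE; lra.
have buv A A' : F A -> E A' -> bu A (u A) /\ bv A' (u A).
  move=> /uP[u01 u0 _] /vP[v01 v0 _]; split; [apply/buE|apply/bvE] => x.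
    by have := u01 x; lra.
  have [Gx|nGx] := pselect (G x); last by rewrite u0//; have := v01 x; lra.
  have nHx : ~ H x by move=> Hx; have : (G `&` H) x by []; rewrite GH.
  by rewrite v0//; have := u01 x; lra.
have [|||h hP] := balls (bu @` F `|` bv @` E).
- by apply: card_lt_setU => //;
    [exact: card_le_lt_trans (card_image_le _ _) ltF
    |exact: card_le_lt_trans (card_image_le _ _) ltE].
- move=> _ [[A FA <-]|[A EA <-]]; first by exists (u A + CKcst cK 1), 1.
  by exists (- v A), 1.
- move=> _ _ [[A FA <-]|[A EA <-]] [[A' FA' <-]|[A' EA' <-]].
  + by exists (CKcst cK 1); split; exact: bu1.
  + by exists (u A); exact: buv.
  + by exists (u A'); apply/and_comm; exact: buv.
  + by exists 0; split; exact: bv0.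
have h1 : closure G `<=` [set x | 1 <= h x].
  have /closure_id -> : closed [set x | 1 <= h x] by exact: closed_CK_le.
  apply: closure_subset => x; rewrite GE => -[A FA Ax] /=.
  have /buE/(_ x) : bu A h by apply: hP; left; exists A.
  by have [_ _ -> //] := uP _ FA; lra.
have h0 : closure H `<=` [set x | h x <= 0].
  have /closure_id -> : closed [set x | h x <= 0] by exact: closed_CK_ge.
  apply: closure_subset => x; rewrite HE => -[A EA Ax] /=.
  have /bvE/(_ x) : bv A h by apply: hP; right; exists A.
  by have [_ _ -> //] := vP _ EA; lra.
by apply/seteqP; split=> // x [/h1 /= + /h0 /=]; lra.
Qed.

Lemma small_cozero_union_closed (G : set K) :
  small_union aleph (cozero_set R cK) G -> small_union aleph (@closed K) G.
Proof.
move=> [F [ltF Fcoz ->]].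
have /choice[f fP] : forall A, exists f, F A ->
    forall x, A x <-> f x != 0.
  move=> A; have [/Fcoz[f ->]|] := pselect (F A); last by exists 0.
  by exists f.
(* A cozero set is the union over [n] of the closed sets where the modulus of its function is at
   least [1 / (n + 1)]. *)
pose B (p : set K * nat) := [set x | p.2.+1%:R^-1 <= `|f p.1 x|].
exists (B @` (F `*` [set: nat])); split.
- exact: card_le_lt_trans (card_image_le _ _) (card_lt_setX_nat _ ltF).
- move=> _ [[A n] _ <-].
  apply: (preimage_closed (f := fun x => `|f A x|)
    (D := [set y | n.+1%:R^-1 <= y])).
    move=> x _; apply: continuous_comp; first exact: CK_continuous.
    exact: norm_continuous.
  exact: closed_ge.
- apply/seteqP; split=> [x [A FA Ax]|x [_ [[A n] [FA _] <-]] /=]; last first.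
    move=> fx; exists A => //; apply/(fP _ FA); rewrite -normr_gt0.
    by apply: lt_le_trans fx; rewrite invr_gt0.
  have fx : 0 < `|f A x| by move/(fP _ FA) : Ax; rewrite normr_gt0.
  have [n _ nf] := near_infty_natSinv_lt (PosNum fx).
  exists (B (A, n)); first by exists (A, n).
  by apply: ltW; exact: (nf n (leqnn n)).
Qed.

End Separation.

(** * Operator norms and small dense subsets *)

Section OperatorNorm.
Variables (R : realType) (X E : normedModType R).
Implicit Types (Y : set X) (t : X -> E).

Lemma subspaceP Y : GRing.submod_closed [in Y] <->
  Y 0 /\ forall (a : R) x y, Y x -> Y y -> Y (a *: x + y).
Proof.
split=> -[Y0 Ylin]; split.
- by rewrite inE in Y0.
- move=> a x y Yx Yy.
  by have := Ylin a x y (mem_set Yx) (mem_set Yy); rewrite inE.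
- by rewrite inE.
- by move=> a x y; rewrite !inE => Yx Yy; exact: Ylin.
Qed.

Lemma operator_on0 Y t : Y 0 -> operator_on Y t -> t 0 = 0.
Proof.
move=> Y0 [/(_ 1 0 0 (mem_set Y0) (mem_set Y0)) + _].
rewrite !scale1r addr0 => /eqP.
by rewrite -subr_eq0 opprD addNKr oppr_eq0 => /eqP.
Qed.

Lemma opnorm_le Y t (c : R) : Y 0 -> 0 <= c ->
  (forall y, Y y -> `|t y| <= c * `|y|) -> opnorm Y t <= c.
Proof.
move=> Y0 c0 tc; apply: ge_sup.
  by exists `|t 0|, 0 => //; split=> //=; rewrite normr0.
move=> _ [y [Yy /= y1] <-]; apply: le_trans (tc y Yy) _.
by rewrite ler_piMr.
Qed.

Lemma opnorm_ubound Y t y : operator_on Y t -> Y y -> `|y| <= 1 ->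
  `|t y| <= opnorm Y t.
Proof.
move=> [_ [M tM]] Yy y1; apply: ub_le_sup; last by exists y.
exists `|M| => _ [z [Yz /= z1] <-].
apply: le_trans (tM z (mem_set Yz)) _; apply: le_trans (ler_norm _) _.
by rewrite normrM normr_id ler_piMr.
Qed.

Lemma opnorm_ge0 Y t : Y 0 -> operator_on Y t -> 0 <= opnorm Y t.
Proof.
move=> Y0 opt; apply: le_trans (opnorm_ubound opt Y0 _); first exact: normr_ge0.
by rewrite normr0.
Qed.

Lemma opnormP Y t y : GRing.submod_closed [in Y] -> operator_on Y t -> Y y ->
  `|t y| <= opnorm Y t * `|y|.
Proof.
move=> /subspaceP[Y0 Ylin] opt Yy; have [->|y0] := eqVneq y 0.
  by rewrite (operator_on0 Y0 opt) !normr0 mulr0.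
have ny0 : 0 < `|y| by rewrite normr_gt0.
have Yz : Y (`|y|^-1 *: y) by rewrite -[_ *: y]addr0; exact: Ylin.
have := opnorm_ubound opt Yz; rewrite normrZ normfV normr_id mulVf ?gt_eqF//.
move=> /(_ (lexx _)); rewrite -[_ *: y]addr0.
rewrite (opt.1 _ _ _ (mem_set Yy) (mem_set Y0)) (operator_on0 Y0 opt) addr0.
by rewrite normrZ normfV normr_id ler_pdivrMl// mulrC.
Qed.

End OperatorNorm.

(** Small density passes to subsets: for each point [d] of a dense set of least cardinality and each
    [n], a point of [D] within [1 / (n + 1)] of [d] is chosen when there is one. *)
Lemma small_dense_subset (R : realType) (X : normedModType R) (aleph : Type)
    (D : set X) : ~ countable [set: aleph] -> dens X #< [set: aleph] ->
  exists S : set X, [/\ S #< [set: aleph], S `<=` D &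
    forall y (e : R), D y -> 0 < e -> exists2 s, S s & `|y - s| < e].
Proof.
move=> uncount ltX.
pose near (p : X * nat) s := D s /\ `|p.1 - s| < p.2.+1%:R^-1.
have /choice[c cP] : forall p : X * nat,
    exists s, (exists y, near p y) -> near p s.
  move=> p; have [[y py]|np] := pselect (exists y, near p y); first by exists y.
  by exists 0.
(* Only indices with a nearby point of [D] are kept, so the default 0 of the choice never enters by
   itself. *)
exists (c @` (dens X `*` [set: nat] `&` [set p | exists y, near p y])); split.
- apply: card_le_lt_trans (card_image_le _ _) _.
  apply: card_le_lt_trans (card_lt_setX_nat uncount ltX).
  exact: subset_card_le.
- by move=> _ [p [_ /cP[Dp _]] <-].
- move=> y e Dy e0; have e20 : 0 < e / 2 by rewrite divr_gt0.
  have [n _ /(_ n (leqnn n)) ne] := near_infty_natSinv_lt (PosNum e20).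
  have [dX _] := densP X.
  have [||d [yd Xd]] := dX (ball y n.+1%:R^-1).
  + by exists y; exact: ballxx.
  + exact: ball_open.
  have nd : near (d, n) y.
    by split=> //=; rewrite distrC; move: yd; rewrite -ball_normE.
  have [_ /= dc] := cP _ (ex_intro _ y nd).
  exists (c (d, n)); first by exists (d, n) => //; split=> //; exists y.
  have -> : y - c (d, n) = - (d - y) + (d - c (d, n)) by rewrite opprB subrKA.
  apply: le_lt_trans (ler_normD _ _) _; rewrite normrN.
  have [_ /= dy] := nd; move: (n.+1%:R^-1) ne dy dc => r /= ne dy dc; lra.
Qed.

(** * Extension of operators; (b) => (a) *)

Section Extension.
Variables (R : realType) (K : topologicalType) (cK : compact [set: K]).
Variable aleph : Type.
Hypothesis aleph_uncountable : ~ countable [set: aleph].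
Hypothesis interp : interpolation R cK aleph.
Variable X : normedModType R.
Hypothesis ltX : dens X #< [set: aleph].
Variable M : R.
Hypothesis M_ge0 : 0 <= M.
Local Notation C := (CK R cK).
Implicit Types (G N : set (X * C)).

(** A partial operator of norm at most [M], encoded by its graph so that chains are bounded by their
    unions. Single-valuedness follows from the norm bound at the vector 0. *)
Definition bounded_linear_graph G : Prop :=
  [/\ G (0, 0),
      forall (a : R) x y f g, G (x, f) -> G (y, g) -> G (a *: x + y, a *: f + g) &
      forall x f, G (x, f) -> `|f| <= M * `|x|].

Lemma bounded_linear_graph_fun G x f g : bounded_linear_graph G ->
  G (x, f) -> G (x, g) -> f = g.
Proof.
move=> [G0 Glin Gbd] Gf Gg; apply/eqP; rewrite -subr_eq0 -normr_le0.
have /Gbd := Glin (-1) _ _ _ _ Gg Gf.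
by rewrite !scaleN1r addNr normr0 mulr0 addrC.
Qed.

Lemma bounded_linear_graphB G x y f g : bounded_linear_graph G ->
  G (x, f) -> G (y, g) -> `|f - g| <= M * `|x - y|.
Proof.
move=> [G0 Glin Gbd] Gf Gg.
have /Gbd := Glin (-1) _ _ _ _ Gg Gf.
by rewrite !scaleN1r addrC (addrC _ x).
Qed.

(** The inequality is what keeps the bound [M] once [x0] is sent to [h]. Interpolation gives it on a
    small dense subset of the domain, and approximation carries it to the rest. *)
Lemma extension_value G (x0 : X) : bounded_linear_graph G ->
  exists h : C, forall x f, G (x, f) -> `|f - h| <= M * `|x - x0|.
Proof.
move=> blG; have [G0 Glin Gbd] := blG.
pose D := [set x | exists f, G (x, f)].
have /choice[phi phiP] : forall x, exists f, D x -> G (x, f).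
  move=> x; have [[f Gf]|nD] := pselect (D x); first by exists f.
  by exists 0.
have [S [ltS SD Sdense]] := small_dense_subset D aleph_uncountable ltX.
have D0 : D 0 by exists 0.
have [s0 Ss0 _] := Sdense 0 1 D0 ltr01.
pose l s : C := phi s - CKcst cK (M * `|s - x0|).
pose u s : C := phi s + CKcst cK (M * `|s - x0|).
have [||||_ _ [s Ss <-] [s' Ss' <-] x|h [lh hu]] :=
  interp (L := l @` S) (U := u @` S).
- by exists (l s0), s0.
- by exists (u s0), s0.
- exact: card_le_lt_trans (card_image_le _ _) ltS.
- exact: card_le_lt_trans (card_image_le _ _) ltS.
- have := bounded_linear_graphB blG (phiP _ (SD _ Ss)) (phiP _ (SD _ Ss')).
  have ss' : M * `|s - s'| <= M * `|s - x0| + M * `|s' - x0|.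
    rewrite -mulrDr ler_wpM2l// [leRHS]addrC (distrC s').
    by rewrite addrC ler_distD.
  have := CK_norm_bounds (phi s - phi s') x.
  by rewrite /l /u !CKE; lra.
have hS s : S s -> `|phi s - h| <= M * `|s - x0|.
  move=> Ss; apply/CK_norm_leP; first by rewrite mulr_ge0.
  move=> x; have := lh _ (ex_intro2 _ _ s Ss erefl) x.
  by have := hu _ (ex_intro2 _ _ s Ss erefl) x; rewrite /l /u !CKE; lra.
exists h => x f Gf; apply/ler_addgt0Pr => e e0.
(* Replacing [x] by [s] costs [M |x - s|] twice; the 1 keeps the divisor positive when [M] is 0. *)
have M1_gt0 : 0 < 2 * M + 1 by rewrite ltr_wpDl// mulr_ge0.
have d0 : 0 < e / (2 * M + 1) by exact: divr_gt0.
have [s Ss xs] := Sdense x _ (ex_intro _ f Gf) d0.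
rewrite -(subrKA (phi s)); apply: le_trans (ler_normD _ _) _.
have := bounded_linear_graphB blG Gf (phiP _ (SD _ Ss)).
have := hS _ Ss.
have : M * `|s - x0| <= M * `|x - s| + M * `|x - x0|.
  by rewrite -mulrDr ler_wpM2l// (distrC x s) ler_distD.
have : 2 * M * `|x - s| <= e.
  apply: (@le_trans _ _ ((2 * M + 1) * `|x - s|)).
    by rewrite ler_wpM2r// lerDl.
  by rewrite mulrC -ler_pdivlMr// ltW.
lra.
Qed.

Lemma extension_graph G : bounded_linear_graph G ->
  exists T : X -> C, bounded_linear_graph [set p | p.2 = T p.1] /\
    forall x f, G (x, f) -> T x = f.
Proof.
move=> blG.
have [|F [A0 FA0] FP totF|N [blN GN maxN]] :=
  @Zorn_bigcup_above _ bounded_linear_graph G.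
- exact: blG.
- split.
  + by exists A0 => //; have [] := FP _ FA0.
  + move=> a x y f g [A FA Af] [B FB Bg].
    have [AB|BA] := totF _ _ FA FB.
      by exists B => //; have [_ + _] := FP _ FB; apply=> //; exact: AB.
    by exists A => //; have [_ + _] := FP _ FA; apply=> //; exact: BA.
  + by move=> x f [A FA Af]; have [_ _] := FP _ FA; apply.
have [N0 Nlin Nbd] := blN.
suff /choice[T TP] : forall x, exists f, N (x, f).
  exists T; split; last first.
    by move=> x f Gf; apply: bounded_linear_graph_fun blN (TP x) _; exact: GN.
  split=> /=.
  - exact: bounded_linear_graph_fun blN N0 (TP 0).
  - move=> a x y f g -> ->.
    by apply: bounded_linear_graph_fun blN _ (TP _); exact: Nlin.
  - by move=> x f ->; exact: Nbd.
move=> x0; have [h hP] := extension_value x0 blN; exists h.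
(* The graph spanned by [N] and [(x0, h)]; by maximality it lies in [N], which puts [(x0, h)]
   there. *)
pose N' := [set p | exists a x f, N (x, f) /\ p = (x + a *: x0, f + a *: h)].
apply: (maxN N').
- by move=> [x f] Nf; exists 0, x, f; rewrite !scale0r !addr0.
- split.
  + by exists 0, 0, 0; rewrite !scale0r !addr0.
  + move=> a _ _ _ _ [b [x [f [Nf [-> ->]]]]] [c [y [g [Ng [-> ->]]]]].
    exists (a * b + c), (a *: x + y), (a *: f + g); split; first exact: Nlin.
    by rewrite !scalerDr !scalerDl !scalerA; congr pair; rewrite addrACA.
  + move=> _ _ [a [x [f [Nf [-> ->]]]]]; have [->|a0] := eqVneq a 0.
      by rewrite !scale0r !addr0; exact: Nbd.
    (* For nonzero [a] the bound at [x + a x0] is [|a|] times the inequality of [h] at [- x / a]. *)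
    have Naf : N (- a^-1 *: x, - a^-1 *: f).
      by rewrite -[X in N (X, _)]addr0 -[X in N (_, X)]addr0; exact: Nlin.
    have na0 : 0 < `|a| by rewrite normr_gt0.
    have := hP _ _ Naf; rewrite -(ler_pM2l na0).
    rewrite mulrCA -!normrZ !scalerBr !scalerA mulrN divff// !scaleN1r.
    by rewrite -!opprD !normrN.
- by exists 1, 0, 0; rewrite !scale1r !add0r.
Qed.

End Extension.

Lemma interpolation_injective (R : realType) (K : topologicalType)
    (cK : compact [set: K]) (aleph : Type) : ~ countable [set: aleph] ->
  interpolation R cK aleph -> one_injective aleph (CK R cK).
Proof.
move=> uncount interp X ltX Y [subY _] t opt.
have [Y0 Ylin] := (subspaceP Y).1 subY.
have M0 := opnorm_ge0 Y0 opt.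
(* The bound is the norm of [t] itself, so the extension does not exceed it. *)
have [|T [[T0 Tlin Tbd] Tt]] := @extension_graph _ _ _ _ uncount interp X ltX _ M0
  [set p | Y p.1 /\ p.2 = t p.1].
  split.
  - by split=> //=; rewrite (operator_on0 Y0 opt).
  - move=> a x y f g [/= Yx ->] [/= Yy ->]; split=> /=; first exact: Ylin.
    by rewrite (opt.1 _ _ _ (mem_set Yx) (mem_set Yy)).
  - by move=> x f [/= Yx ->]; exact: opnormP.
exists T; split.
- split; last by exists (opnorm Y t) => x _; exact: Tbd.
  by move=> a x y _ _; symmetry; exact: (Tlin a x y _ _ erefl erefl).
- by move=> y /set_mem Yy; exact: Tt.
- by apply: opnorm_le => // x _; exact: Tbd.
Qed.

(** * A small Banach space of bounded functions *)

(* The bounded functions that are uniform limits of rational combinations of [B];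
   they form a real Banach space, whose density is at most the number of such
   combinations. *)
Section UniformSpan.
Variables (R : realType) (S : Type) (B : set (S -> R)).
Implicit Types (f g : S -> R) (s : seq (rat * B)).

Definition rat_comb s : S -> R := \sum_(p <- s) ratr p.1 *: val p.2.

Lemma rat_comb_cat s1 s2 : rat_comb (s1 ++ s2) = rat_comb s1 + rat_comb s2.
Proof. by rewrite /rat_comb big_cat. Qed.

Lemma rat_comb_scale (q : rat) s :
  rat_comb [seq (q * p.1, p.2) | p <- s] = ratr q *: rat_comb s.
Proof.
rewrite /rat_comb big_map scaler_sumr; apply: eq_bigr => p _ /=.
by rewrite scalerA rmorphM.
Qed.

Definition bounded_fct f : Prop := exists M : R, forall x, `|f x| <= M.

Definition uspan : {pred S -> R} := fun f => `[< bounded_fct f /\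
  forall e : R, 0 < e -> exists s, forall x, `|f x - rat_comb s x| <= e >].

Lemma uspanP f : f \in uspan <-> (bounded_fct f /\
  forall e : R, 0 < e -> exists s, forall x, `|f x - rat_comb s x| <= e).
Proof. by split=> [/asboolP|fP]//; exact/asboolP. Qed.

Lemma bounded_fct_close f g (e : R) : bounded_fct f ->
  (forall x, `|f x - g x| <= e) -> bounded_fct g.
Proof.
move=> [M fM] fg; exists (M + e) => x.
have -> : g x = f x - (f x - g x) by rewrite opprB addrC subrK.
by apply: le_trans (ler_normB _ _) _; rewrite lerD.
Qed.

(** [B] may contain unbounded functions, so a rational combination need not be bounded; one that
    stays close to a member of [uspan] is. *)
Lemma rat_comb_uspan f s (e : R) : f \in uspan ->
  (forall x, `|f x - rat_comb s x| <= e) -> rat_comb s \in uspan.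
Proof.
move=> /uspanP[bf _] fs; apply/uspanP; split.
  exact: bounded_fct_close bf fs.
by move=> e' e'0; exists s => x; rewrite subrr normr0 ltW.
Qed.

Lemma mem_uspan f : B f -> bounded_fct f -> f \in uspan.
Proof.
move=> Bf bf; apply/uspanP; split=> // e e0.
exists [:: (1, SigSub (mem_set Bf))] => x.
by rewrite /rat_comb big_seq1 /= rmorph1 scale1r subrr normr0 ltW.
Qed.

Lemma rat_approx (a e : R) : 0 < e -> exists q : rat, `|a - ratr q| < e.
Proof.
move=> e0; have [||x [/= ae [q _ qx]]] := @dense_rat R (ball a e).
- by exists a; exact: ballxx.
- exact: ball_open.
by exists q; move: ae; rewrite qx -ball_normE.
Qed.

Lemma uspan_submod_closed : submod_closed uspan.
Proof.
split.
  apply/uspanP; split=> [|e e0]; first by exists 0 => x; rewrite normr0.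
  by exists [::] => x; rewrite /rat_comb big_nil subrr normr0 ltW.
move=> a f g /uspanP[[M fM] fs] /uspanP[[N gN] gs]; apply/uspanP; split.
  exists (`|a| * M + N) => x; apply: le_trans (ler_normD _ _) _.
  by apply: lerD => //; rewrite normrM ler_wpM2l.
(* One third of [e] each goes to replacing [a] by a rational [q], to approximating [f] and to
   approximating [g]. The first two errors are scaled by [M] and [q], whence the divisors, kept
   positive by the 1. *)
move=> e e0; have M1 : 0 < `|M| + 1 by rewrite ltr_wpDl.
have [q aq] := rat_approx a (divr_gt0 (divr_gt0 e0 (ltr0Sn R 2)) M1).
have q1 : 0 < `|ratr q : R| + 1 by rewrite ltr_wpDl.
have [s fsP] := fs _ (divr_gt0 (divr_gt0 e0 (ltr0Sn R 2)) q1).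
have [s' gsP] := gs _ (divr_gt0 e0 (ltr0Sn R 2)).
exists ([seq (q * p.1, p.2) | p <- s] ++ s') => x.
rewrite rat_comb_cat rat_comb_scale.
have -> : (a *: f + g) x - (ratr q *: rat_comb s + rat_comb s') x =
    (a - ratr q) * f x + ratr q * (f x - rat_comb s x) + (g x - rat_comb s' x).
  have rE (b c y z y' z' : R) : b * y + z - (c * y' + z') =
      (b - c) * y + c * (y - y') + (z - z') by ring.
  exact: rE.
have -> : e = e / 3 + e / 3 + e / 3 by lra.
apply: le_trans (ler_normD _ _) _; apply: lerD (gsP x).
apply: le_trans (ler_normD _ _) _; apply: lerD; rewrite normrM.
  apply: le_trans (_ : _ <= `|a - ratr q| * (`|M| + 1)) _.
    rewrite ler_wpM2l//; apply: le_trans (fM x) _.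
    by apply: le_trans (ler_norm M) _; rewrite lerDl.
  by rewrite -ler_pdivlMr// ltW.
apply: le_trans (_ : _ <= (`|ratr q| + 1) * `|f x - rat_comb s x|) _.
  by rewrite ler_wpM2r// lerDl.
by rewrite mulrC -ler_pdivlMr.
Qed.

HB.instance Definition _ :=
  GRing.isSubmodClosed.Build R (S -> R) uspan uspan_submod_closed.

Record uspanType :=
  USpan { uspan_fun : S -> R; uspan_funP : uspan_fun \in uspan }.

HB.instance Definition _ := [isSub for uspan_fun].
HB.instance Definition _ := [Choice of uspanType by <:].
HB.instance Definition _ := [SubChoice_isSubLmodule of uspanType by <:].

Implicit Types (u v w : uspanType).

Lemma uspan_funDE u v x : uspan_fun (u + v) x = uspan_fun u x + uspan_fun v x.
Proof. by []. Qed.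
Lemma uspan_funNE u x : uspan_fun (- u) x = - uspan_fun u x.
Proof. by []. Qed.
Lemma uspan_funZE (a : R) u x : uspan_fun (a *: u) x = a * uspan_fun u x.
Proof. by []. Qed.
Definition uspan_funE := (uspan_funDE, uspan_funNE, uspan_funZE).

End UniformSpan.

Section UniformSpanNorm.
Variables (R : realType) (S : Type) (B : set (S -> R)).
Local Notation X := (uspanType B).
Implicit Types u v w : X.

Definition unorm u : R := sup [set `|uspan_fun u x| | x in [set: S]].

Lemma le_unorm u x : `|uspan_fun u x| <= unorm u.
Proof.
apply: ub_le_sup; last by exists x.
have /uspanP[[M uM] _] := uspan_funP u.
by exists M => _ [y _ <-].
Qed.

Lemma unorm_le u (M : R) :
  0 <= M -> (forall x, `|uspan_fun u x| <= M) -> unorm u <= M.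
Proof.
move=> M0 uM; have [u0|/set0P u0] :=
    eqVneq [set `|uspan_fun u x| | x in [set: S]] set0.
  by rewrite /unorm u0 sup0.
by apply: ge_sup => // _ [x _ <-].
Qed.

Lemma unorm_ge0 u : 0 <= unorm u.
Proof.
rewrite /unorm; have [->|/set0P[_ [x _ _]]] :=
  eqVneq [set `|uspan_fun u x| | x in [set: S]] set0; first by rewrite sup0.
exact: le_trans (le_unorm u x).
Qed.

Lemma unormD u v : unorm (u + v) <= unorm u + unorm v.
Proof.
apply: unorm_le => [|x]; first by rewrite addr_ge0 ?unorm_ge0.
by apply: le_trans (ler_normD _ _) _; rewrite lerD ?le_unorm.
Qed.

Lemma unormZ (a : R) u : unorm (a *: u) = `|a| * unorm u.
Proof.
have le b v : unorm (b *: v) <= `|b| * unorm v.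
  apply: unorm_le => [|x]; first by rewrite mulr_ge0 ?unorm_ge0.
  by rewrite [X in X <= _]normrM ler_wpM2l ?le_unorm.
apply/eqP; rewrite eq_le le/=.
have [->|a0] := eqVneq a 0; first by rewrite normr0 mul0r unorm_ge0.
rewrite -[in leLHS](scale1r u) -(mulVf a0) -scalerA.
apply: le_trans (ler_wpM2l _ (le _ _)) _ => //.
by rewrite mulrA -normrM divff// normr1 mul1r.
Qed.

Lemma unorm_eq0 u : unorm u = 0 -> u = 0.
Proof.
move=> u0; apply: val_inj; apply/funext => x; apply/eqP; rewrite -normr_le0 -u0.
exact: le_unorm.
Qed.

HB.instance Definition _ :=
  @Lmodule_isNormed.Build R X unorm unormD unormZ unorm_eq0.

Lemma uspan_norm_leP u (a : R) :
  0 <= a -> `|u| <= a <-> forall x, `|uspan_fun u x| <= a.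
Proof.
move=> a0; split=> [ua x|]; first exact: le_trans (le_unorm u x) ua.
exact: unorm_le.
Qed.

(** The pointwise limit of a Cauchy filter is a uniform limit, because the Cauchy inequality
    survives a limit in one variable. Being uniformly close to members of [uspan], it is bounded and
    approximable by combinations. *)
Lemma uspan_complete (F : set_system X) : ProperFilter F -> cauchy F -> cvg F.
Proof.
move=> FF /cauchy_ballP cF.
have cl (x : S) : exists l : R, uspan_fun u x @[u --> F] --> l.
  apply/cvg_ex/cauchy_cvgP/cauchy_ballP => e e0.
  have [[A D] /= [FA FD] AD] := cF e e0.
  exists ([set uspan_fun f x | f in A], [set uspan_fun f x | f in D]) => /=.
    split; first by apply: filterS FA => f Af; exists f.
    by apply: filterS FD => f Df; exists f.
  move=> [_ _] /= [[f Af <-] [g Dg <-]].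
  have := AD (f, g) (conj Af Dg); rewrite -!ball_normE /= => fg.
  exact: le_lt_trans (le_unorm (f - g) x) fg.
have [l {}cl] := choice cl.
have unif (e : R) : 0 < e ->
    \forall u \near F, forall x, `|l x - uspan_fun u x| <= e.
  move=> e0; have := cF e e0; rewrite !near_simpl => /nearP_dep.
  apply: filterS => f fg x.
  have cf :
      `|uspan_fun h x - uspan_fun f x| @[h --> F] --> `|l x - uspan_fun f x|.
    by apply: cvg_norm; apply: cvgB (cl x) (cvg_cst (uspan_fun f x)).
  apply: (closed_cvg (fun y : R => y <= e) (@closed_le R e) _ _ cf).
  apply: filterS fg => h; rewrite -ball_normE /= => fh.
  by rewrite distrC; apply: ltW; exact: le_lt_trans (le_unorm (f - h) x) fh.
have lP : l \in uspan B.
  apply/uspanP; split.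
    have /filter_ex[u ul] := unif 1 ltr01.
    have /uspanP[bu _] := uspan_funP u.
    by apply: bounded_fct_close bu _ => x; rewrite distrC.
  move=> e e0; have e20 : 0 < e / 2 by rewrite divr_gt0.
  have /filter_ex[u ul] := unif _ e20.
  have /uspanP[_ /(_ _ e20)[s us]] := uspan_funP u.
  exists s => x; rewrite -(subrKA (uspan_fun u x)) [e]splitr.
  by apply: le_trans (ler_normD _ _) _; rewrite lerD.
apply/cvg_ex; exists (USpan lP); apply/cvgrPdist_le => e e0.
apply: filterS (unif e e0) => u ul.
by apply/uspan_norm_leP => [|x]; [exact: ltW|exact: ul].
Qed.

HB.instance Definition _ := Uniform_isComplete.Build X uspan_complete.

Lemma card_lt_dens_uspan (aleph : Type) : ~ countable [set: aleph] ->
  B #< [set: aleph] -> dens X #< [set: aleph].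
Proof.
move=> uncount ltB.
(* [insubd] turns combinations outside [uspan] into 0; those that approximate a member stay as they
   are, by [rat_comb_uspan]. *)
pose D : set X :=
  range (fun s : seq (rat * B) => insubd (0 : X) (rat_comb s)).
have [_ /(_ D) leD] := densP X.
apply: card_le_lt_trans (card_lt_seq uncount ltB).
apply: card_le_trans (leD _) _.
  move=> V [u Vu] oV; have := open_nbhs_nbhs (conj oV Vu).
  move=> /nbhs_ballP[e /= e0 uV]; have e20 : 0 < e / 2 by rewrite divr_gt0.
  have /uspanP[_ /(_ _ e20)[s us]] := uspan_funP u.
  have sP := rat_comb_uspan (uspan_funP u) us.
  have sE : uspan_fun (insubd (0 : X) (rat_comb s)) = rat_comb s.
    exact: insubdK.
  exists (insubd (0 : X) (rat_comb s)); split; last by exists s.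
  apply: uV; rewrite -ball_normE /=; apply: (@le_lt_trans _ _ (e / 2)).
    by apply/uspan_norm_leP => [|x]; [exact: ltW|rewrite !uspan_funE sE].
  by rewrite ltr_pdivrMr// ltr_pMr// ltr1n.
apply: card_le_trans (card_image_le _ _) _.
(* Rational coefficients are coded by natural numbers to match [card_lt_seq]. *)
apply: (@inj_card_leT _ _ (map (fun p : rat * B => (choice.pickle p.1, p.2)))).
by apply: inj_map => -[q b] [q' b'] /= [/(pcan_inj choice.pickleK)-> ->].
Qed.

End UniformSpanNorm.

(** * Positivity of unital contractions; (a) => (b) *)

Section Interpolation.
Variables (R : realType) (K : topologicalType) (cK : compact [set: K]).
Local Notation C := (CK R cK).

Lemma operator_contractive (X E : normedModType R) (T : X -> E) :
  operator_on [set: X] T -> opnorm [set: X] T <= 1 -> forall u, `|T u| <= `|u|.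
Proof.
move=> opT T1 u; have subT : GRing.submod_closed [in [set: X]].
  by apply/subspaceP.
apply: le_trans (opnormP subT opT I) _.
by rewrite ler_piMl.
Qed.

(* If [0 <= u <= c] then [`|c - u| <= c], hence [c - T u <= c]. *)
Lemma unital_contraction_positive (B : set (K -> R)) (T : uspanType B -> C)
    (e u : uspanType B) :
  operator_on [set: uspanType B] T -> (forall u, `|T u| <= `|u|) ->
  (forall x, uspan_fun e x = 1) -> T e = CKcst cK 1 ->
  (forall x, 0 <= uspan_fun u x) -> forall x, 0 <= T u x.
Proof.
move=> [Tlin _] T1 e1 Te u0 x.
have Tu : `| `|u| *: e - u| <= `|u|.
  apply/uspan_norm_leP => // y; rewrite !uspan_funE e1 mulr1.
  have := le_unorm u y; rewrite ger0_norm// => uy.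
  by rewrite ger0_norm ?subr_ge0// gerBl.
have Tlin2 : T (`|u| *: e - u) = `|u| *: T e - T u.
  have T0 : T 0 = 0.
    apply: (@operator_on0 _ _ _ setT) => //.
    by split=> //; exists 1 => v _; rewrite mul1r.
  rewrite Tlin ?in_setT//; congr (_ + _).
  have := Tlin (-1) u 0 (in_setT _) (in_setT _).
  by rewrite T0 !addr0 !scaleN1r.
have := CK_norm_bounds (T (`|u| *: e - u)) x.
have := le_trans (T1 (`|u| *: e - u)) Tu.
by rewrite Tlin2 Te !CKE; lra.
Qed.

Lemma injective_interpolation (aleph : Type) : ~ countable [set: aleph] ->
  one_injective aleph (CK R cK) -> interpolation R cK aleph.
Proof.
move=> uncount inj L U [f0 Lf0] [g0 Ug0] ltL ltU LU.
pose h0 x := sup [set CK_fun f x | f in L].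
have Lh0 f x : L f -> f x <= h0 x.
  move=> Lf; apply: ub_le_sup; last by exists f.
  by exists (g0 x) => _ [g Lg <-]; exact: LU.
have h0U g x : U g -> h0 x <= g x.
  move=> Ug; apply: ge_sup; first by exists (f0 x), f0.
  by move=> _ [f Lf <-]; exact: LU.
(* The constant 1 is included to make the extension unital, and [h0] because its image will
   interpolate. *)
pose B : set (K -> R) :=
  [set CK_fun f | f in L `|` U `|` [set CKcst cK 1]] `|` [set h0].
have ltB : B #< [set: aleph].
  apply: card_lt_setU => //; last exact/countable_card_lt/countable1.
  apply: card_le_lt_trans (card_image_le _ _) _.
  apply: card_lt_setU => //; last exact/countable_card_lt/countable1.
  exact: card_lt_setU.
have CB f : (L `|` U `|` [set CKcst cK 1]) f -> CK_fun f \in uspan B.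
  move=> Ff; apply: mem_uspan; first by left; exists f.
  by exists `|f| => x; exact: le_CKnorm.
have h0B : h0 \in uspan B.
  apply: mem_uspan; first by right.
  exists (`|f0| + `|g0|) => x; rewrite ler_norml.
  have := Lh0 f0 x Lf0; have := h0U g0 x Ug0.
  have := CK_norm_bounds f0 x; have := CK_norm_bounds g0 x.
  have := normr_ge0 f0; have := normr_ge0 g0; lra.
pose Y : set (uspanType B) := [set u | continuous (uspan_fun u)].
have subY : closed_subspace Y.
  split.
    apply/subspaceP; split=> [x|a u v Yu Yv x]; first exact: cvg_cst.
    apply: (@continuousD R R^o _ (fun x => a * uspan_fun u x)); last exact: Yv.
    by apply: continuousM; [exact: cvg_cst|exact: Yu].
  move=> u clu x; apply/cvgrPdist_le => e e0.
  have e3 : 0 < e / 3 by rewrite divr_gt0.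
  have [v [Yv]] := clu _ (nbhsx_ballx u _ e3).
  rewrite -ball_normE /= => /ltW/uspan_norm_leP => /(_ (ltW e3)) uv.
  have /cvgrPdist_le/(_ _ e3) := Yv x; apply: filterS => y vxy.
  have -> : uspan_fun u x - uspan_fun u y = (uspan_fun u x - uspan_fun v x) +
      (uspan_fun v x - uspan_fun v y) + (uspan_fun v y - uspan_fun u y).
    by rewrite !addrA !subrK.
  have -> : e = e / 3 + e / 3 + e / 3 by lra.
  apply: le_trans (ler_normD _ _) _; apply: lerD; last by rewrite distrC uv.
  by apply: le_trans (ler_normD _ _) _; apply: lerD => //; exact: uv.
(* The inclusion of [Y] into [C(K)]; the value 0 off [Y] is a dummy. *)
pose t (u : uspanType B) : C :=
  if pselect (continuous (uspan_fun u)) is left cu then mkCK cK cu else 0.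
have tE u x : Y u -> t u x = uspan_fun u x.
  by rewrite /t; case: pselect.
have tb u : Y u -> `|t u| <= 1 * `|u|.
  by move=> Yu; rewrite mul1r; apply: CKnorm_le => // x; rewrite tE ?le_unorm.
have opt : operator_on Y t.
  split; last by exists 1 => u /set_mem; exact: tb.
  move=> a u v /set_mem Yu /set_mem Yv; apply: CKP => x; rewrite !CKE !tE//.
  by have [_] := (subspaceP Y).1 subY.1; apply.
have Y0 : Y 0 by have [] := (subspaceP Y).1 subY.1.
have [T [opT Tt normT]] := inj _ (card_lt_dens_uspan uncount ltB) _ subY t opt.
have T1 := operator_contractive opT (le_trans normT (opnorm_le Y0 ler01 tb)).
have TC f (Ff : (L `|` U `|` [set CKcst cK 1]) f) : T (USpan (CB f Ff)) = f.
  have Yf : Y (USpan (CB f Ff)) by move=> x; exact: CK_continuous.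
  by rewrite Tt ?inE//; apply: CKP => x; rewrite tE.
pose H : uspanType B := USpan h0B.
have F1 : (L `|` U `|` [set CKcst cK 1]) (CKcst cK 1) by right.
have pos := unital_contraction_positive opT T1 _ (TC _ F1).
have Tlin v w : T (v - w) = T v - T w.
  have := opT.1 (-1) w v (in_setT _) (in_setT _).
  by rewrite !scaleN1r addrC => ->; rewrite addrC.
(* [T] fixes the members of [L] and [U], so positivity at [h0 - f] for [f] in [L] and at [f - h0]
   for [f] in [U] gives the two inequalities. *)
exists (T H); split=> f Ff x.
  have FLf : (L `|` U `|` [set CKcst cK 1]) f by left; left.
  rewrite -subr_ge0.
  have : 0 <= CK_fun (T (H - USpan (CB f FLf))) x.
    by apply: pos => // y; rewrite !uspan_funE subr_ge0; exact: Lh0.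
  by rewrite Tlin TC.
have FUf : (L `|` U `|` [set CKcst cK 1]) f by left; right.
rewrite -subr_ge0.
have : 0 <= CK_fun (T (USpan (CB f FUf) - H)) x.
  by apply: pos => // y; rewrite !uspan_funE subr_ge0; exact: h0U.
by rewrite Tlin TC.
Qed.

End Interpolation.

Theorem theorem4p2 (R : realType) (K : topologicalType)
    (cK : compact [set: K]) (hK : hausdorff_space K)
    (aleph : Type) (haleph : ~ countable [set: aleph]) :
  [<-> (* a *) one_injective aleph (CK R cK);
    (* b *)
    forall L U : set (CK R cK), L !=set0 -> U !=set0 ->
      L #< [set: aleph] -> U #< [set: aleph] ->
      (forall f g, L f -> U g -> forall x, f x <= g x) ->
      exists h : CK R cK, (forall f, L f -> forall x, f x <= h x) /\
        (forall g, U g -> forall x, h x <= g x);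
    (* c *)
    forall B : set (set (CK R cK)), B #< [set: aleph] ->
      (forall A, B A -> exists f r, 0 <= r /\ A = closed_ball_ Num.norm f r) ->
      (forall A A', B A -> B A' -> A `&` A' !=set0) ->
      \bigcap_(A in B) A !=set0;
    (* d *)
    forall G H : set K, open G -> open H -> G `&` H = set0 ->
      small_union aleph closed G -> small_union aleph closed H ->
      closure G `&` closure H = set0;
    (* e *)
    forall G H : set K, open G -> open H -> G `&` H = set0 ->
      small_union aleph (@cozero_set R K cK) G ->
      small_union aleph (@cozero_set R K cK) H ->
      closure G `&` closure H = set0].
Proof.
split; first exact: injective_interpolation.
split; first exact: interpolation_ball_intersection.
split; first exact: ball_intersection_separation.
split=> [sep|sep].
  move=> G H oG oH GH sG sH.
  by apply: sep => //;
    [exact: small_cozero_union_closed sG|exact: small_cozero_union_closed sH].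
(* The cycle closes from (e) to (a) by way of (b). *)
apply: interpolation_injective => //.
exact: separation_interpolation.
Qed.
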